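(* Suppose the data assumption stated in the context holds and let $H\ge3$. For every $\mathcal{S}=\llbracket 1,r\rrbracket$ with $0\le r<r_{max}$, there exist both a tightened (first-order) critical point of $L$ associated with $\mathcal{S}$ and a non-tightened (first-order) critical point of $L$ associated with $\mathcal{S}$.
   Context: Setting. Let $H\ge 2$ and let $d_0,\dots,d_H,m$ be positive integers; write $d_x=d_0$, $d_y=d_H$, $r_{max}=\min(d_H,\dots,d_0)$. Parameters are $\mathbf{W}=(W_H,\dots,W_1)$ with $W_h\in\mathbb{R}^{d_h\times d_{h-1}}$. Given data $X\in\mathbb{R}^{d_x\times m}$, $Y\in\mathbb{R}^{d_y\times m}$, the loss is $L(\mathbf{W})=\|W_H\cdots W_1X-Y\|^2$ (Frobenius norm). Set $\Sigma_{XX}=XX^T$, $\Sigma_{XY}=XY^T$, $\Sigma_{YX}=YX^T$. Data assumption. $d_y\le d_x\le m$, $\Sigma_{XX}$ is invertible, $\Sigma_{XY}$ has full rank $d_y$, and, with $\Sigma^{1/2}=\Sigma_{YX}\Sigma_{XX}^{-1}X\in\mathbb{R}^{d_y\times m}$ and $\Sigma=\Sigma^{1/2}(\Sigma^{1/2})^T=\Sigma_{YX}\Sigma_{XX}^{-1}\Sigma_{XY}$, the singular values of $\Sigma^{1/2}$ are all distinct (i.e. $\Sigma$ has $d_y$ distinct eigenvalues). Let $\Sigma^{1/2}=U\Delta V^T$ be a singular value decomposition with $U\in\mathbb{R}^{d_y\times d_y}$, $V\in\mathbb{R}^{m\times m}$ orthogonal and the diagonal entries of $\Delta\in\mathbb{R}^{d_y\times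 m}$ in decreasing order. Notation. $\llbracket a,b\rrbracket$ is the set of integers from $a$ to $b$ (empty if $a>b$). $A_{\mathcal{J}}$ is the submatrix of $A$ formed by the columns indexed by $\mathcal{J}$. A product of a matrix with 0 columns and a matrix with 0 rows is the zero matrix of the appropriate size; in particular $U_\emptyset U_\emptyset^T=0$. $W_h\cdots W_{h'}$ with $h>h'$ is the product in decreasing index order, equals $W_h$ if $h=h'$, and $I_{d_h}$ if $h'=h+1$. A first-order critical point is a $\mathbf{W}$ with $\nabla L(\mathbf{W})=0$ (gradient with respect to all entries). For every first-order critical point $\mathbf{W}$, with $r=\operatorname{rk}(W_H\cdots W_1)$, there is a unique $\mathcal{S}\subset\llbracket 1,d_y\rrbracket$ of size $r$ such that $W_H\cdots W_1=U_{\mathcal{S}}U_{\mathcal{S}}^T\Sigma_{YX}\Sigma_{XX}^{-1}$; $\mathbf{W}$ is said to be associated with $\mathcal{S}$. Tightened. A pivot is a pair $(i,j)\in\llbracket1,H\rrbracket^2$ with $i>j$. Its two complementary blocks are $W_{j-1}\cdots W_1\Sigma_{XY}W_H\cdots W_{i+1}$ and $W_{i-1}\cdots W_{j+1}$, where empty products are identities: e.g. if $i=H$ and $j=1$ the first block is $\Sigma_{XY}$, and if $i=j+1$ the second block is $I_{d_j}$. For a first-order critical point $\mathbf{W}$ with $r=\operatorname{rk}(W_H\cdots W_1)$, a pivot is tightened if at least one of its two complementary blocks has rank $r$; $\mathbf{W}$ is tightened if every pivot is tightened, and non-tightened otherwise. *)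

(* Defs.v *)
From HB Require Import structures.
From mathcomp Require Import all_boot all_order all_algebra.
From mathcomp Require Import reals topology normedtype derive.

Set Implicit Arguments.
Unset Strict Implicit.
Unset Printing Implicit Defensive.

Import Order.TTheory GRing.Theory Num.Theory.
Import numFieldNormedType.Exports.

Local Open Scope ring_scope.

Section LinearAlgebra.
Variable R : realType.

Definition frob2 (m n : nat) (A : 'M[R]_(m, n)) : R :=
  \sum_i \sum_j A i j ^+ 2.

Definition orthogonal (n : nat) (A : 'M[R]_n) : Prop := A *m A^T = 1%:M.

(* The diagonal positions of a rectangular matrix are compared as naturals. *)
Definition is_svd (p q : nat) (A : 'M[R]_(p, q))
    (U : 'M[R]_p) (D : 'M[R]_(p, q)) (V : 'M[R]_q) : Prop :=
  [/\ A = U *m D *m V^T,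
      orthogonal U,
      orthogonal V,
      forall (i : 'I_p) (j : 'I_q), i <> j :> nat -> D i j = 0 &
      (forall (i : 'I_p) (j : 'I_q), i = j :> nat -> 0 <= D i j) /\
      (forall (i1 i2 : 'I_p) (j1 j2 : 'I_q),
          i1 = j1 :> nat -> i2 = j2 :> nat -> (i1 <= i2)%N ->
          D i2 j2 <= D i1 j1)].

Definition colset (p q : nat) (A : 'M[R]_(p, q)) (S : {set 'I_q}) :
    'M[R]_(p, #|S|) :=
  colsub (fun k : 'I_#|S| => enum_val k) A.

End LinearAlgebra.

Section Data.
Variables (R : realType) (dx dy m : nat).
Variables (X : 'M[R]_(dx, m)) (Y : 'M[R]_(dy, m)).

Definition SigmaXX : 'M[R]_dx := X *m X^T.
Definition SigmaXY : 'M[R]_(dx, dy) := X *m Y^T.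
Definition SigmaYX : 'M[R]_(dy, dx) := Y *m X^T.

Definition Sigma_half : 'M[R]_(dy, m) := SigmaYX *m invmx SigmaXX *m X.
Definition Sigma : 'M[R]_dy := Sigma_half *m Sigma_half^T.

(* The last clause says that the singular values of Sigma_half are pairwise
   distinct: their squares are the eigenvalues of the dy x dy matrix Sigma. *)
Definition data_assumption : Prop :=
  [/\ (dy <= dx <= m)%N,
      SigmaXX \in unitmx,
      \rank SigmaXY = dy &
      exists s : seq R,
        [/\ uniq s, size s = dy & all (eigenvalue Sigma) s]].

End Data.

Section Network.
Variables (R : realType) (H : nat) (d : nat -> nat).

(* Layer indices are shifted: W h is W_{h+1} in 1-based numbering.  Only the
   widths d 0, ..., d H matter. *)
Definition params : Type := forall h : 'I_H, 'M[R]_(d h.+1, d h).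

Definition layer (W : params) (h : nat) : 'M[R]_(d h.+1, d h) :=
  match @idP (h < H)%N with
  | ReflectT lt_hH => W (Ordinal lt_hH)
  | ReflectF _ => 0
  end.

(* chain W b a is W_b ... W_{a+1} in 1-based numbering, for a <= b <= H.
   When b = a the matrix pid_mx (d a) is the identity of order d a; this form
   is used because it is well typed without rewriting b into a.  The values
   for b < a are irrelevant. *)
Fixpoint chain (W : params) (b a : nat) : 'M[R]_(d b, d a) :=
  match b return 'M[R]_(d b, d a) with
  | 0 => pid_mx (d a)
  | b'.+1 => if (b' < a)%N then pid_mx (d a)
             else layer W b' *m chain W b' a
  end.

Definition end_to_end (W : params) : 'M[R]_(d H, d 0%N) := chain W H 0%N.

Definition rmax : nat := \big[minn/d 0%N]_(h < H.+1) d h.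

Section Loss.
Variables (m : nat) (X : 'M[R]_(d 0%N, m)) (Y : 'M[R]_(d H, m)).

Definition loss (W : params) : R := frob2 (end_to_end W *m X - Y).

(* shift_entry W h i j t is W + t E, where E has a single nonzero entry, equal to 1, at position (i, j)
   of layer h. *)
Definition shift_entry (W : params) (h i j : nat) (t : R) : params :=
  fun k => W k + \matrix_(a, b)
             (if [&& k == h :> nat, a == i :> nat & b == j :> nat]
              then t else 0).

Definition partial_loss (W : params) (h i j : nat) : R :=
  derive1 (fun t : R => loss (shift_entry W h i j t)) 0.

Definition gradient (W : params) : params :=
  fun h => \matrix_(i, j) partial_loss W h i j.

Definition critical (W : params) : Prop := forall h, gradient W h = 0.

Definition associated (U : 'M[R]_(d H)) (W : params) (S : {set 'I_(d H)}) :
    Prop :=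
  #|S| = \rank (end_to_end W) /\
  end_to_end W =
    colset U S *m (colset U S)^T *m SigmaYX X Y *m invmx (SigmaXX X).

(* The indices of a pivot (i, j) are 1-based. *)
Definition block1 (W : params) (i j : nat) : 'M[R]_(d j.-1, d i) :=
  chain W j.-1 0%N *m SigmaXY X Y *m chain W H i.

Definition block2 (W : params) (i j : nat) : 'M[R]_(d i.-1, d j) :=
  chain W i.-1 j.

Definition tightened_pivot (W : params) (i j : nat) : Prop :=
  \rank (block1 W i j) = \rank (end_to_end W) \/
  \rank (block2 W i j) = \rank (end_to_end W).

Definition tightened (W : params) : Prop :=
  forall i j : nat, (1 <= j)%N -> (j < i)%N -> (i <= H)%N ->
    tightened_pivot W i j.

End Loss.
End Network.

(* Main.v *)
Require Import Defs.
From HB Require Import structures.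
From mathcomp Require Import all_boot all_order all_algebra.
From mathcomp Require Import reals topology normedtype derive.
From mathcomp Require Import boolp functions zify ring.

Set Implicit Arguments.
Unset Strict Implicit.
Unset Printing Implicit Defensive.

Import Order.TTheory GRing.Theory Num.Theory.
Import numFieldNormedType.Exports.

Local Open Scope ring_scope.

(** Throughout, [N] is the least-squares regressor Sigma_YX Sigma_XX^-1, [P] is
    [pid_mx r], and Sigma = N Sigma_XY.  Both critical points belong to one
    family, indexed by a width k with r <= k <= min_h d_h:

      W_1 = pid_mx r *m (U^T *m N),   W_h = pid_mx k  (1 < h < H),
      W_H = U *m pid_mx r.

    The outer layers already cut the rank down to r, so k changes neither the
    end-to-end map U P U^T N, nor the partial products that start at the first
    layer or end at the last one; it only shows in products of inner layers.

    Criticality holds for every k.  By [gradientE] the gradient in layer h is,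
    up to a factor 2, the residual (W_H ... W_1 X - Y) X^T between the
    transposes of the products of the layers above and below h.  The residual
    is (U P U^T - 1) Sigma_YX.  When h < H, the factor from above contributes
    P U^T on the left, which kills U P U^T - 1 by orthogonality of U
    ([residual_left]).  When h = H, the factor from below contributes
    N^T U P on the right, and Sigma_YX N^T U P = Sigma U P = U L P, where
    L = D D^T is diagonal; as L commutes with P, this is U P L, which
    U P U^T - 1 sends to 0 ([residual_right]).

    A pivot (i, j) with i > j + 1 has second block [pid_mx k], of rank k.  For
    k = r it is tightened.  The remaining pivots have i = j + 1, and their first
    block has rank r, because it is one of Sigma_XY U P, P U^T Sigma and
    P U^T Sigma U P (with rectangular versions of P) and Sigma_XY has full
    column rank while Sigma is positive definite; since H >= 3, the case of a
    first block equal to Sigma_XY itself does not occur among them.  So k = r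
    gives a tightened point.  For k = r + 1, which is available as r < r_max, the
    pivot (H, 1) has blocks Sigma_XY and [pid_mx (r + 1)], of ranks d_y > r and
    r + 1, so the point is not tightened. *)

(** * Real matrices *)

Section RealMatrices.
Variable R : realType.

Lemma frob2_tr (p q : nat) (A : 'M[R]_(p, q)) : frob2 A = \tr (A *m A^T).
Proof.
by apply: eq_bigr => i _; rewrite mxE; apply: eq_bigr => j _; rewrite mxE expr2.
Qed.

Lemma frob2_line (p q : nat) (C G : 'M[R]_(p, q)) (t : R) :
  frob2 (C + t *: G) = frob2 C + 2 * \tr (C *m G^T) * t + frob2 G * t ^+ 2.
Proof.
have trGC : \tr (G *m C^T) = \tr (C *m G^T).
  by rewrite -mxtrace_tr trmx_mul trmxK.
rewrite !frob2_tr linearD linearZ /= mulmxDl !mulmxDr.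
rewrite -!scalemxAl -!scalemxAr !mxtraceD !mxtraceZ trGC.
by ring.
Qed.

(** Along a coordinate line the loss is quadratic, so this is the only derivative
    the gradient requires. *)
Lemma derive1_quadratic (a b c : R) :
  derive1 (fun t : R => a + b * t + c * t ^+ 2) 0 = b.
Proof.
pose f : R^o -> R^o := cst a + b \*: (@id R^o) + c \*: ((@id R^o) ^+ 2).
have -> : (fun t : R => a + b * t + c * t ^+ 2) = f by [].
rewrite derive1E /f derive_val expr1 mulr0 scale0r scaler0 addr0 add0r.
exact: mulr1.
Qed.

Lemma mxtrace_mul_delta (p q : nat) (A : 'M[R]_(p, q)) i j :
  \tr (A *m delta_mx j i) = A i j.
Proof.
rewrite /mxtrace (bigD1 i) //= big1 ?addr0 => [|k neq_ki].
  rewrite mxE (bigD1 j) //= big1 ?addr0 => [|l neq_lj].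
    by rewrite mxE !eqxx mulr1.
  by rewrite mxE (negPf neq_lj) mulr0.
by rewrite mxE big1 // => l _; rewrite mxE (negPf neq_ki) andbF mulr0.
Qed.

Lemma mulmx_tr_eq0 (p q : nat) (A : 'M[R]_(p, q)) : A *m A^T = 0 -> A = 0.
Proof.
move=> AA0; have /eqP: frob2 A = 0 by rewrite frob2_tr AA0 mxtrace0.
rewrite psumr_eq0 => [/allP A0|i _]; last first.
  by rewrite sumr_ge0 // => j _; rewrite sqr_ge0.
apply/matrixP => i j; rewrite mxE.
have := A0 i (mem_index_enum _).
rewrite psumr_eq0 => [/allP Ai0|k _]; last exact: sqr_ge0.
by have := Ai0 j (mem_index_enum _); rewrite /= sqrf_eq0 => /eqP.
Qed.

(** If v A A^T = 0 then (v A)(v A)^T = 0, hence v A = 0 and v = 0. *)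
Lemma row_free_gram_unit (p q : nat) (A : 'M[R]_(p, q)) :
  row_free A -> A *m A^T \in unitmx.
Proof.
move=> freeA; rewrite -row_free_unit -kermx_eq0; set K := kermx _.
have KAA0 : K *m (A *m A^T) = 0 by rewrite mulmx_ker.
have KA0 : K *m A = 0.
  by apply: mulmx_tr_eq0; rewrite trmx_mul mulmxA -(mulmxA K) KAA0 mul0mx.
by rewrite -(mulmx_free_eq0 K freeA) KA0.
Qed.

Lemma diag_mx_pid (n r : nat) (L : 'M[R]_n) :
  is_diag_mx L -> L *m pid_mx r = pid_mx r *m L.
Proof.
move=> /diag_mxP[e ->].
have /diag_mxP[f ->] : is_diag_mx (pid_mx r : 'M[R]_n).
  by apply/is_diag_mxP => i j neq_ij; rewrite mxE (negPf neq_ij).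
exact: diag_mxC.
Qed.

(** A principal block of an invertible diagonal matrix is invertible, since
    [L] commutes with [pid_mx r]; the outer factors only pad the block with
    zeros.  Padding once more to size [n] turns it into [pid_mx r *m L]. *)
Lemma rank_pid_compress (a b n r : nat) (L : 'M[R]_n) :
    (r <= a)%N -> (r <= b)%N -> (r <= n)%N -> L \in unitmx -> is_diag_mx L ->
  \rank ((pid_mx r : 'M_(a, n)) *m L *m (pid_mx r : 'M_(n, b))) = r.
Proof.
move=> le_ra le_rb le_rn unitL diagL; set M := _ *m _ *m _.
apply/eqP; rewrite eqn_leq; apply/andP; split.
  by rewrite (leq_trans (mxrankM_maxr _ _)) // rank_pid_mx.
have <- : \rank ((pid_mx r : 'M_(n, a)) *m M *m (pid_mx r : 'M_(b, n))) = r.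
  rewrite /M !mulmxA pid_mx_id // -!mulmxA pid_mx_id // diag_mx_pid //.
  by rewrite mulmxA pid_mx_id // mxrankMfree ?rank_pid_mx // row_free_unit.
by rewrite (leq_trans (mxrankM_maxl _ _)) // mxrankM_maxr.
Qed.

(** Converts the column-selection form of the projector into a product with
    [pid_mx], in which all later computations take place. *)
Lemma colset_proj (p n r : nat) (U : 'M[R]_(p, n)) :
  let S := [set i : 'I_n | (i < r)%N] in
  colset U S *m (colset U S)^T = U *m pid_mx r *m U^T.
Proof.
move=> S; apply/matrixP => i j; rewrite !mxE.
under eq_bigr do rewrite !mxE.
rewrite -(big_enum_val (fun k => U i k * U j k)) /=.
rewrite big_mkcond /=; apply: eq_bigr => k _.
rewrite !mxE (bigD1 k) //= mxE eqxx /= big1 ?addr0 => [|l neq_lk].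
  by rewrite inE; case: ifP; rewrite ?mulr1 ?mulr0 ?mul0r.
by rewrite mxE val_eqE (negPf neq_lk) mulr0.
Qed.

Lemma card_ord_lt (n r : nat) : (r <= n)%N -> #|[set i : 'I_n | (i < r)%N]| = r.
Proof.
move=> le_rn; rewrite cardsE -sum1_card; under eq_bigl do rewrite unfold_in /=.
by rewrite -(big_ord_widen n (fun _ => 1%N) le_rn) sum1_card card_ord.
Qed.

End RealMatrices.

(** * Products of consecutive layers *)

Section Chains.
Variables (R : realType) (H : nat) (d : nat -> nat).
Implicit Types W : params R H d.

Lemma layerE W (h : 'I_H) : layer W h = W h.
Proof.
case: h => h lt_hH; rewrite /layer; case: {-}_ / idP => [lt_hH'|] //=.
by rewrite (bool_irrelevance lt_hH' lt_hH).
Qed.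

Lemma chain_nn W a : chain W a a = 1%:M.
Proof. by case: a => [|a] /=; rewrite ?ltnSn pid_mx_1. Qed.

Lemma chain_recl W a b :
  (a <= b)%N -> chain W b.+1 a = layer W b *m chain W b a.
Proof. by move=> /= le_ab; rewrite ltnNge le_ab. Qed.

Lemma chain_cat W a c b : (a <= c)%N -> (c <= b)%N ->
  chain W b a = chain W b c *m chain W c a.
Proof.
move=> le_ac; elim: b => [|b IHb].
  by rewrite leqn0 => /eqP ->; rewrite chain_nn mul1mx.
rewrite leq_eqVlt => /predU1P[-> | le_cb]; first by rewrite chain_nn mul1mx.
by rewrite !chain_recl ?(leq_trans le_ac) // IHb // mulmxA.
Qed.

Lemma eq_chain W W' a b : (a <= b)%N ->
  (forall h, (a <= h < b)%N -> layer W h = layer W' h) ->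
  chain W b a = chain W' b a.
Proof.
elim: b => [|b IHb]; first by rewrite leqn0 => /eqP ->; rewrite !chain_nn.
rewrite leq_eqVlt => /predU1P[-> _ | le_ab eqW]; first by rewrite !chain_nn.
rewrite !chain_recl // eqW ?ltnSn ?andbT //; congr (_ *m _).
apply: IHb => // h /andP[le_ah lt_hb].
by rewrite eqW // le_ah ltnW.
Qed.

Lemma end_to_end_split (W : params R H d) (h : 'I_H) :
  end_to_end W = chain W H h.+1 *m W h *m chain W h 0.
Proof.
rewrite /end_to_end (chain_cat W (leq0n h.+1)) //.
by rewrite chain_recl // layerE mulmxA.
Qed.

End Chains.

(** * The gradient of the loss *)

Section Gradient.
Variables (R : realType) (H : nat) (d : nat -> nat) (m : nat).
Variables (X : 'M[R]_(d 0%N, m)) (Y : 'M[R]_(d H, m)).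

Lemma end_to_end_shift (W : params R H d) (h : 'I_H)
    (i : 'I_(d h.+1)) (j : 'I_(d h)) (t : R) :
  end_to_end (shift_entry W h i j t) =
  end_to_end W + t *: (chain W H h.+1 *m delta_mx i j *m chain W h 0).
Proof.
have layer_neq (k : nat) : k <> h -> layer (shift_entry W h i j t) k = layer W k.
  rewrite /layer; case: {-}_ / idP => // lt_kH neq_kh.
  by apply/matrixP => a b; rewrite !mxE /=; case: eqP => //= _; rewrite addr0.
rewrite (end_to_end_split W h) (end_to_end_split (shift_entry W h i j t) h).
rewrite -(eq_chain (W := W) (W' := shift_entry W h i j t)) //; last first.
  move=> k /andP[lt_hk _]; rewrite layer_neq // => eq_kh.
  by rewrite eq_kh ltnn in lt_hk.
rewrite -(eq_chain (W := W) (W' := shift_entry W h i j t)) //; last first.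
  move=> k lt_kh; rewrite layer_neq // => eq_kh.
  by rewrite eq_kh ltnn in lt_kh.
have -> : shift_entry W h i j t h = W h + t *: delta_mx i j.
  apply/matrixP => a b; rewrite !mxE eqxx /= -!val_eqE.
  by case: ifP => _; rewrite ?mulr1 ?mulr0.
by rewrite mulmxDr mulmxDl -scalemxAr -scalemxAl.
Qed.

(** The end-to-end map is affine in a single entry of layer [h], so with
    C = W_H ... W_1 X - Y and G = L E_ij R X the partial derivative is 2 tr (C G^T),
    which is the (i, j) entry of 2 L^T C X^T R^T by cyclicity of the trace. *)
Lemma gradientE (W : params R H d) (h : 'I_H) :
  gradient X Y W h =
  2 *: ((chain W H h.+1)^T *m (end_to_end W *m X - Y) *m X^T *m
        (chain W h 0)^T).
Proof.
apply/matrixP => i j; rewrite [LHS]mxE /partial_loss.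
pose C := end_to_end W *m X - Y.
pose G := chain W H h.+1 *m delta_mx i j *m chain W h 0 *m X.
have -> : (fun t => loss X Y (shift_entry W h i j t)) =
          (fun t => frob2 C + 2 * \tr (C *m G^T) * t + frob2 G * t ^+ 2).
  apply/funext => t; rewrite -frob2_line /loss end_to_end_shift.
  by rewrite mulmxDl -scalemxAl addrAC.
rewrite derive1_quadratic [RHS]mxE; congr (_ * _).
rewrite /G !trmx_mul trmx_delta !mulmxA mxtrace_mulC !mulmxA.
by rewrite mxtrace_mul_delta.
Qed.

End Gradient.

(** * The family of bottleneck networks *)

Lemma rmax_le (H : nat) (d : nat -> nat) (h : nat) :
  (h <= H)%N -> (rmax H d <= d h)%N.
Proof.
move=> le_hH; rewrite /rmax -(big_mkord xpredT d).
have: h \in index_iota 0 H.+1 by rewrite mem_index_iota.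
elim: index_iota => // k s IHs; rewrite big_cons inE geq_min.
by case/predU1P => [-> | /IHs ->]; rewrite ?leqnn ?orbT.
Qed.

Section Bottleneck.
Variables (R : realType) (n : nat) (d : nat -> nat).
Variables (B : 'M[R]_(d n.+1)) (A : 'M[R]_(d n.+1, d 0%N)) (r k : nat).

(** The number of layers is written [n.+1] so that the last layer, of index [n],
    has an output of type [d n.+1] without any cast.
    The factors [pid_mx (d 0%N)] and [pid_mx (d n.+1)] are identities in the only
    layers where they occur; they give both branches the type required for an
    arbitrary [h]. *)
Definition bottleneck_layer (h : nat) : 'M[R]_(d h.+1, d h) :=
  if h == 0%N then pid_mx r *m A *m pid_mx (d 0%N)
  else if h == n then pid_mx (d n.+1) *m B *m pid_mx r
  else pid_mx k.

Definition bottleneck : params R n.+1 d := fun h => bottleneck_layer h.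

Hypothesis n_gt0 : (0 < n)%N.
Hypothesis le_rk : (r <= k)%N.
Hypothesis k_le_width : forall h, (h <= n.+1)%N -> (k <= d h)%N.

Let r_le_width h : (h <= n.+1)%N -> (r <= d h)%N.
Proof. by move=> /k_le_width; apply: leq_trans. Qed.

Lemma layer_bottleneck h : (h <= n)%N -> layer bottleneck h = bottleneck_layer h.
Proof. by move=> le_hn; rewrite (layerE _ (Ordinal (le_hn : h < n.+1)%N)). Qed.

Lemma chain_bottleneck_mid a b : (0 < a)%N -> (a < b)%N -> (b <= n)%N ->
  chain bottleneck b a = pid_mx k.
Proof.
move=> a_gt0; elim: b => // b IHb; rewrite ltnS => le_ab lt_bn.
have layer_b : layer bottleneck b = pid_mx k.
  rewrite layer_bottleneck 1?ltnW // /bottleneck_layer.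
  by rewrite (ltn_eqF lt_bn) gtn_eqF // (leq_trans a_gt0).
rewrite chain_recl // layer_b.
case: (ltngtP a b) le_ab => // [lt_ab _ | <- _].
  by rewrite IHb // 1?ltnW // pid_mx_id // k_le_width // ltnW // ltnW.
by rewrite chain_nn mulmx1.
Qed.

Lemma chain_bottleneck_low b : (0 < b)%N -> (b <= n)%N ->
  chain bottleneck b 0 = pid_mx r *m A.
Proof.
move=> b_gt0 le_bn.
have chain1 : chain bottleneck 1 0 = pid_mx r *m A.
  rewrite chain_recl // chain_nn mulmx1 layer_bottleneck //.
  by rewrite /bottleneck_layer /= pid_mx_1 mulmx1.
case: (ltngtP 1%N b) b_gt0 => // [lt_1b _ | <- _ //].
rewrite (chain_cat bottleneck (leq0n 1) (ltnW lt_1b)) chain1.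
rewrite chain_bottleneck_mid // mulmxA mul_pid_mx (minn_idPr le_rk).
by rewrite (minn_idPr _) // r_le_width.
Qed.

Lemma chain_bottleneck_high a : (0 < a)%N -> (a <= n)%N ->
  chain bottleneck n.+1 a = B *m pid_mx r.
Proof.
move=> a_gt0 le_an; rewrite chain_recl // layer_bottleneck //.
rewrite /bottleneck_layer eqxx gtn_eqF // pid_mx_1 mul1mx.
case: (ltngtP a n) le_an => // [lt_an _ | -> _]; last by rewrite chain_nn mulmx1.
rewrite chain_bottleneck_mid // -mulmxA mul_pid_mx (minn_idPl le_rk).
by rewrite (minn_idPr _) // r_le_width.
Qed.

Lemma end_to_end_bottleneck : end_to_end bottleneck = B *m pid_mx r *m A.
Proof.
rewrite /end_to_end (@chain_cat _ _ _ bottleneck 0 1) //.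
rewrite chain_bottleneck_high // chain_bottleneck_low //.
by rewrite mulmxA -(mulmxA B) pid_mx_id // r_le_width.
Qed.

Section Critical.
Variables (m : nat) (X : 'M[R]_(d 0%N, m)) (Y : 'M[R]_(d n.+1, m)).

Let residual := (B *m pid_mx r *m A *m X - Y) *m X^T.

(** The two conditions are the vanishing of the gradient up to rectangular
    factors [pid_mx r]: the first one covers every layer but the last, whose
    transposed chain above ends in [pid_mx r *m B^T]; the second one covers the
    last layer, whose transposed chain below starts with [A^T *m pid_mx r]. *)
Lemma critical_bottleneck :
    (pid_mx r : 'M_(d n.+1)) *m B^T *m residual = 0 ->
    residual *m A^T *m (pid_mx r : 'M_(d n.+1)) = 0 ->
  critical X Y bottleneck.
Proof.
move=> left0 right0 h; rewrite gradientE end_to_end_bottleneck -(mulmxA _ _ X^T).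
rewrite -/residual; move: residual left0 right0 => res left0 right0.
(* Any rectangular [pid_mx r] factors through the square one of size
   [d n.+1], which exposes the two hypotheses. *)
have idem a b : (pid_mx r : 'M[R]_(a, b)) =
    (pid_mx r : 'M_(a, d n.+1)) *m (pid_mx r : 'M_(d n.+1, b)).
  by rewrite pid_mx_id // r_le_width.
case: (ltngtP h n) => [lt_hn | | eq_hn]; last first.
- rewrite chain_bottleneck_low ?eq_hn // trmx_mul tr_pid_mx idem.
  rewrite (mulmxA A^T) (mulmxA _ (A^T *m _)) -(mulmxA _ res) (mulmxA res).
  by rewrite right0 mulmx0 mul0mx scaler0.
- by rewrite ltnNge -ltnS ltn_ord.
rewrite chain_bottleneck_high // trmx_mul tr_pid_mx idem.
by rewrite -(mulmxA _ _ B^T) -(mulmxA _ _ res) left0 mulmx0 mul0mx scaler0.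
Qed.

End Critical.

End Bottleneck.

(** * The data matrices in the basis of singular vectors *)

Section Data.
Variables (R : realType) (dx dy m : nat).
Variables (X : 'M[R]_(dx, m)) (Y : 'M[R]_(dy, m)).
Variables (U : 'M[R]_dy) (D : 'M[R]_(dy, m)) (V : 'M[R]_m) (r : nat).
Hypothesis data : data_assumption X Y.
Hypothesis svd : is_svd (Sigma_half X Y) U D V.

Let N := SigmaYX X Y *m invmx (SigmaXX X).
Let A := U^T *m N.
Let P : 'M[R]_dy := pid_mx r.

Lemma svd_basis_trmx_mul : U^T *m U = 1%:M.
Proof. by case: svd => _ orthU _ _ _; apply: mulmx1C. Qed.

Lemma svd_basis_unit : U \in unitmx.
Proof. by case: (mulmx1_unit svd_basis_trmx_mul). Qed.

Lemma tr_SigmaXX : (SigmaXX X)^T = SigmaXX X.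
Proof. by rewrite trmx_mul trmxK. Qed.

Lemma tr_SigmaYX : (SigmaYX X Y)^T = SigmaXY X Y.
Proof. by rewrite trmx_mul trmxK. Qed.

Lemma Sigma_regressor : Sigma X Y = N *m SigmaXY X Y.
Proof.
case: data => _ unitXX _ _.
rewrite /Sigma /Sigma_half -/N trmx_mul mulmxA -(mulmxA N X) -/(SigmaXX X).
by rewrite /N mulmxKV // trmx_mul trmx_inv tr_SigmaXX tr_SigmaYX mulmxA.
Qed.

Lemma row_free_regressor : row_free N.
Proof.
case: data => _ unitXX rankXY _.
rewrite /row_free mxrankMfree ?row_free_unit ?unitmx_inv //.
by rewrite -mxrank_tr tr_SigmaYX rankXY.
Qed.

(** Sigma is the Gram matrix of Sigma_half, whose rows are independent because
    those of N and of X are. *)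
Lemma Sigma_unit : Sigma X Y \in unitmx.
Proof.
case: data => _ unitXX _ _; apply: row_free_gram_unit.
rewrite /Sigma_half -/N /row_free mxrankMfree ?(eqP row_free_regressor) //.
rewrite /row_free eqn_leq rank_leq_row -{1}(mxrank_unit unitXX).
exact: mxrankM_maxl.
Qed.

Lemma Sigma_diagonalized : U^T *m Sigma X Y *m U = D *m D^T.
Proof.
case: svd => eqZ _ orthV _ _.
rewrite /Sigma eqZ !trmx_mul trmxK !mulmxA svd_basis_trmx_mul mul1mx.
rewrite -(mulmxA _ V^T V) (mulmx1C orthV) mulmx1 -mulmxA svd_basis_trmx_mul.
by rewrite mulmx1.
Qed.

Lemma gram_diag_unit : D *m D^T \in unitmx.
Proof.
rewrite -Sigma_diagonalized !unitmx_mul unitmx_tr Sigma_unit.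
by rewrite svd_basis_unit.
Qed.

Lemma is_diag_gram : is_diag_mx (D *m D^T).
Proof.
case: svd => _ _ _ offD _; apply/is_diag_mxP => i j neq_ij.
rewrite mxE big1 // => l _; rewrite !mxE.
case: (eqVneq (i : nat) l) => [eq_il | /eqP neq_il]; last first.
  by rewrite (offD i l neq_il) mul0r.
rewrite (offD j) ?mulr0 // => eq_jl.
by rewrite eq_il eq_jl eqxx in neq_ij.
Qed.

Let residual := (U *m P *m A *m X - Y) *m X^T.

Lemma residualE : residual = (U *m P *m U^T - 1%:M) *m SigmaYX X Y.
Proof.
case: data => _ unitXX _ _.
rewrite /residual mulmxBl -!mulmxA -/(SigmaXX X) -/(SigmaYX X Y).
rewrite mulmxBl mul1mx /A /N -!mulmxA mulVmx // mulmx1.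
by rewrite !mulmxA.
Qed.

Let PP : P *m P = P.
Proof. by rewrite mul_pid_mx minnn pid_mx_minv. Qed.

Lemma residual_left : P *m U^T *m residual = 0.
Proof.
suff proj0 : P *m U^T *m (U *m P *m U^T - 1%:M) = 0.
  by rewrite residualE mulmxA proj0 mul0mx.
rewrite mulmxBr mulmx1 !mulmxA -(mulmxA P) svd_basis_trmx_mul mulmx1 PP.
exact: subrr.
Qed.

Lemma tr_Sigma : (Sigma X Y)^T = Sigma X Y.
Proof. by rewrite trmx_mul trmxK. Qed.

Lemma Sigma_svd_basis : Sigma X Y *m U = U *m (D *m D^T).
Proof.
case: svd => _ orthU _ _ _.
by rewrite -Sigma_diagonalized !mulmxA orthU mul1mx.
Qed.

(** Sigma U = U L with L diagonal: the span of the first r singular vectors is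
    invariant under Sigma, so the projector fixes what it receives. *)
Lemma residual_right : residual *m A^T *m P = 0.
Proof.
have YXN : SigmaYX X Y *m N^T = Sigma X Y.
  by rewrite -tr_Sigma Sigma_regressor (trmx_mul N) -tr_SigmaYX trmxK.
rewrite residualE trmx_mul trmxK mulmxA -(mulmxA _ (SigmaYX X Y)) YXN.
rewrite -(mulmxA _ _ U) Sigma_svd_basis (mulmxA _ U) -(mulmxA _ _ P).
rewrite (diag_mx_pid _ is_diag_gram) !mulmxA.
suff -> : (U *m P *m U^T - 1%:M) *m U *m P = 0 by rewrite !mul0mx.
rewrite mulmxBl mul1mx -(mulmxA _ U^T) svd_basis_trmx_mul mulmx1 mulmxBl.
by rewrite -(mulmxA U) PP subrr.
Qed.

Lemma rank_projected_regressor : (r <= dy)%N ->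
  \rank (U *m P *m A) = r.
Proof.
move=> le_r.
rewrite mulmxA mxrankMfree ?row_free_regressor //.
rewrite mxrankMfree ?row_free_unit ?unitmx_tr ?svd_basis_unit //.
by rewrite eqmxMfull ?row_full_unit ?svd_basis_unit // rank_pid_mx.
Qed.

Lemma rank_block_low a : (r <= a)%N -> (r <= dy)%N ->
  \rank ((pid_mx r : 'M_(a, dy)) *m A *m SigmaXY X Y) = r.
Proof.
move=> le_ra le_r.
rewrite /A -(mulmxA _ _ (SigmaXY X Y)) -(mulmxA U^T) -Sigma_regressor.
rewrite mulmxA mxrankMfree ?row_free_unit ?Sigma_unit //.
by rewrite mxrankMfree ?row_free_unit ?unitmx_tr ?svd_basis_unit ?rank_pid_mx.
Qed.

Lemma rank_block_high b : (r <= b)%N -> (r <= dy)%N ->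
  \rank (SigmaXY X Y *m (U *m (pid_mx r : 'M_(dy, b)))) = r.
Proof.
case: data => _ _ rankXY _ le_rb le_r.
rewrite eqmxMfull; last by rewrite /row_full rankXY.
by rewrite eqmxMfull ?row_full_unit ?svd_basis_unit // rank_pid_mx.
Qed.

Lemma rank_block_inner a b : (r <= a)%N -> (r <= b)%N -> (r <= dy)%N ->
  \rank ((pid_mx r : 'M_(a, dy)) *m A *m SigmaXY X Y *m
         (U *m (pid_mx r : 'M_(dy, b)))) = r.
Proof.
move=> le_ra le_rb le_r.
rewrite /A -(mulmxA _ _ (SigmaXY X Y)) -(mulmxA U^T) -Sigma_regressor.
rewrite (mulmxA _ U) -(mulmxA _ _ U) Sigma_diagonalized.
by rewrite rank_pid_compress // ?gram_diag_unit ?is_diag_gram.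
Qed.

End Data.

(** * Tightened and non-tightened points *)

Theorem proposition8 (R : realType) (H : nat) (d : nat -> nat) (m : nat)
    (hH : (3 <= H)%N)
    (hd : forall h : nat, (h <= H)%N -> (0 < d h)%N)
    (hm : (0 < m)%N)
    (X : 'M[R]_(d 0%N, m)) (Y : 'M[R]_(d H, m))
    (hdata : data_assumption X Y)
    (U : 'M[R]_(d H)) (D : 'M[R]_(d H, m)) (V : 'M[R]_m)
    (hsvd : is_svd (Sigma_half X Y) U D V)
    (r : nat) (hr : (r < rmax H d)%N) :
  let S := [set i : 'I_(d H) | (i < r)%N] in
  (exists W : params R H d,
      [/\ critical X Y W, associated X Y U W S & tightened X Y W]) /\
  (exists W : params R H d,
      [/\ critical X Y W, associated X Y U W S & ~ tightened X Y W]).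
Proof.
case: H => [|n] // in hH hd X Y hdata U D V hsvd hr *.
have r_lt_width h : (h <= n.+1)%N -> (r < d h)%N.
  by move=> le_h; apply: leq_trans hr (rmax_le d le_h).
have r_le_width h : (h <= n.+1)%N -> (r <= d h)%N by move=> /r_lt_width/ltnW.
have n_gt0 : (0 < n)%N by apply: ltnW.
move=> S.
pose A := U^T *m (SigmaYX X Y *m invmx (SigmaXX X)).
pose W k := bottleneck U A r k.
have W_critical k : (r <= k)%N -> (forall h, (h <= n.+1)%N -> (k <= d h)%N) ->
    critical X Y (W k) /\ associated X Y U (W k) S.
  move=> le_rk k_le_width; split.
    apply: critical_bottleneck => //; first exact: residual_left hdata hsvd.
    exact: residual_right hdata hsvd.
  rewrite /associated end_to_end_bottleneck //; split.
    by rewrite (rank_projected_regressor hdata hsvd) ?card_ord_lt ?r_le_width.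
  by rewrite colset_proj !mulmxA.
have rankE k : (r <= k)%N -> (forall h, (h <= n.+1)%N -> (k <= d h)%N) ->
    \rank (end_to_end (W k)) = r.
  move=> le_rk k_le_width; rewrite end_to_end_bottleneck //.
  by rewrite (rank_projected_regressor hdata hsvd) ?r_le_width.
split; [exists (W r) | exists (W r.+1)].
  have [crit assoc] := W_critical r (leqnn r) r_le_width; split=> //.
  move=> i j j_gt0 lt_ji le_iH; rewrite /tightened_pivot rankE //.
  (* The second block is a nonempty product of inner layers iff j + 1 < i. *)
  have [lt_j1i | ] := ltnP j.+1 i.
    right; rewrite /block2 chain_bottleneck_mid //.
    - by rewrite rank_pid_mx // r_le_width //; lia.
    - lia.
    - lia.
  move=> le_ij; have eq_i : i = j.+1 by apply/eqP; rewrite eqn_leq le_ij.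
  left; rewrite eq_i in le_iH *; rewrite /block1.
  have [-> | neq_j1] := eqVneq j 1%N.
    (* Here i = 2 < H because H >= 3, so the first block is not Sigma_XY. *)
    rewrite chain_nn mul1mx chain_bottleneck_high //.
    by rewrite (rank_block_high hdata hsvd) // r_le_width //; lia.
  rewrite chain_bottleneck_low //; [|lia|lia].
  have [eq_jn | neq_jn] := eqVneq j n.
    rewrite eq_jn chain_nn mulmx1.
    by rewrite (rank_block_low hdata hsvd) // r_le_width //; lia.
  rewrite chain_bottleneck_high //; last by lia.
  by rewrite (rank_block_inner hdata hsvd) // r_le_width //; lia.
have [crit assoc] := W_critical r.+1 (leqnSn r) r_lt_width; split=> //.
move=> /(_ n.+1 1%N isT (n_gt0 : (1 < n.+1)%N) (leqnn _)) [] /eqP.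
  rewrite rankE // /block1 !chain_nn mul1mx mulmx1.
  by case: hdata => _ _ -> _; rewrite gtn_eqF // r_lt_width.
rewrite rankE // /block2 chain_bottleneck_mid //.
by rewrite rank_pid_mx ?gtn_eqF ?r_lt_width //; lia.
Qed.
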